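(* Let $k\geq 3$ and $n\geq 3$ be odd integers and let $G$ be a connected graph of order $n$. If $\lambda_1(D(G))\le \lambda_1(D(K_1\vee(K_{n-2}\cup K_1)))$, then $G$ is $\mathrm{GFC}_k$ unless $G\cong K_1\vee(K_{n-2}\cup K_1)$.
   Context: All graphs are finite, simple, undirected. For a connected graph $G$, $D(G)$ is its distance matrix (entry $(i,j)$ is the distance between $v_i$ and $v_j$) and $\lambda_1(D(G))$ its largest eigenvalue. $G\cup H$ is disjoint union, $G\vee H$ the join, $tK_1$ the edgeless graph on $t$ vertices. For a graph $H$, $i(H)$ is the number of isolated vertices of $H$ and $\mathrm{odd}(H)$ the number of components of $H$ with an odd number ($\ge 3$) of vertices, i.e. nontrivial odd components. The $k$-Berge–Tutte formula is $\mathrm{def}_k(G)=\max_{S\subseteq V(G)} \big(k\, i(G-S)-k|S|\big)$ if $k$ is even, and $\max_{S\subseteq V(G)}\big(\mathrm{odd}(G-S)+k\, i(G-S)-k|S|\big)$ if $k$ is odd; a set $S$ attaining the maximum is a $k$-barrier. A connected graph of odd order is $\mathrm{GFC}_k$ (generalized factor-critical about integer $k$-matching) if it has no non-empty $k$-barrier. *)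

(* Defs.v *)
From HB Require Import structures.
From mathcomp Require Import all_boot all_order all_fingroup all_algebra.
From mathcomp Require Import classical_sets reals.
Set Implicit Arguments. Unset Strict Implicit. Unset Printing Implicit Defensive.
Import Order.TTheory GRing.Theory Num.Theory.

Definition simple_graph (n : nat) (e : rel 'I_n) : Prop :=
  symmetric e /\ irreflexive e.

Definition connected_graph (n : nat) (e : rel 'I_n) : Prop :=
  forall x y : 'I_n, connect e x y.

Fixpoint walk (n : nat) (e : rel 'I_n) (k : nat) (x y : 'I_n) : bool :=
  match k with
  | 0 => x == y
  | k'.+1 => [exists z, e x z && walk e k' z y]
  end.

(* Distance: least k (< n) with a walk of length k from x to y.  In a
   connected graph on n vertices the distance is always < n, so this is the
   usual graph distance. *)
Definition gdist (n : nat) (e : rel 'I_n) (x y : 'I_n) : nat :=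
  find (fun k => walk e k x y) (iota 0 n).

Definition distmx (R : realType) (n : nat) (e : rel 'I_n) : 'M[R]_n :=
  \matrix_(i, j) ((gdist e i j)%:R)%R.

Definition lambda1 (R : realType) (n : nat) (A : 'M[R]_n) : R :=
  sup [set x : R | eigenvalue A x].

(* K_1 \/ (K_{n-2} \cup K_1) on 'I_n: vertex 0 is the dominating vertex,
   vertex n-1 is the pendant vertex, the others form K_{n-2}. *)
Definition kbar (n : nat) : rel 'I_n :=
  fun i j => (i != j) &&
    [|| val i == 0%N, val j == 0%N | (val i != n.-1) && (val j != n.-1)].

Definition graph_iso (n : nat) (e h : rel 'I_n) : Prop :=
  exists f : {perm 'I_n}, forall x y, e x y = h (f x) (f y).

Definition del_rel (n : nat) (e : rel 'I_n) (S : {set 'I_n}) : rel 'I_n :=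
  fun x y => [&& e x y, x \notin S & y \notin S].

Definition iso_vertices (n : nat) (e : rel 'I_n) (S : {set 'I_n}) : nat :=
  #|[set v in ~: S | [forall u in ~: S, ~~ e v u]]|.

Definition comp_of (n : nat) (e : rel 'I_n) (S : {set 'I_n}) (v : 'I_n)
  : {set 'I_n} := [set u in ~: S | connect (del_rel e S) v u].

Definition components (n : nat) (e : rel 'I_n) (S : {set 'I_n})
  : {set {set 'I_n}} := [set comp_of e S v | v in ~: S].

Definition odd_comps (n : nat) (e : rel 'I_n) (S : {set 'I_n}) : nat :=
  #|[set C in components e S | odd #|C| && (3 <= #|C|)%N]|.

(* the quantity maximised in the k-Berge-Tutte formula *)
Definition bt_val (k n : nat) (e : rel 'I_n) (S : {set 'I_n}) : int :=
  if odd k then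
    ((odd_comps e S)%:Z + (k * iso_vertices e S)%:Z - (k * #|S|)%:Z)%R
  else ((k * iso_vertices e S)%:Z - (k * #|S|)%:Z)%R.

Definition k_barrier (k n : nat) (e : rel 'I_n) (S : {set 'I_n}) : Prop :=
  forall T : {set 'I_n}, (bt_val k e T <= bt_val k e S)%R.

Definition GFC (k n : nat) (e : rel 'I_n) : Prop :=
  connected_graph e /\ odd n /\
  forall S : {set 'I_n}, S != finset.set0 -> ~ k_barrier k e S.

Arguments kbar : clear implicits.

(* Main.v *)
Require Import Defs.
From mathcomp Require Import all_boot all_order all_fingroup all_algebra.
From mathcomp Require Import classical_sets reals.
From mathcomp Require Import ring lra zify.
Import Order.TTheory GRing.Theory Num.Theory.

(* Let S be a non-empty k-barrier of e, with s = |S|, i isolated vertices and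
   q nontrivial odd components in the graph minus S.  As the empty set has
   value at least 1, k s < q + k i.  Distances are at least 1, and at least 2
   between non-adjacent vertices, so a nonnegative test vector x gives
   (lambda1 + 1) |x|^2 >= (sum x)^2 + sum of x_u x_v over the ordered
   non-adjacent pairs; for kbar, X = lambda1 + 1 is a root of
   X^3 - n X^2 - 3 (n - 2) X + (n - 2).
   - If s = 1 <= i then e is a proper spanning subgraph of kbar, and the Perron
     vector of kbar is a strict test vector.
   - If i < s then q > 3 (s - i), and if i >= s >= 2 the isolated vertices are
     numerous; both produce so many non-adjacent pairs that the all-ones vector
     suffices, except for n = 5, where s = 2 and i = 3. *)

Set Implicit Arguments.
Unset Strict Implicit.
Unset Printing Implicit Defensive.

(** * Rayleigh quotients of symmetric matrices *)

Lemma mul_le_norm_of_sqr_le (R : realFieldType) (a u v N : R) :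
  (u ^+ 2 <= N -> v ^+ 2 <= N -> a * (u * v) <= `|a| * N)%R.
Proof.
move=> hu hv.
have h0 : (u * v <= N)%R by have := sqr_ge0 (u - v)%R; nra.
have h1 : (- (u * v) <= N)%R by have := sqr_ge0 (u + v)%R; nra.
by case: (ger0P a) => ha; nra.
Qed.

Section QuadraticForm.
Local Open Scope ring_scope.
Variables (R : realFieldType) (n : nat).
Implicit Types (A B : 'M[R]_n) (x y : 'rV[R]_n).

Definition qform A x : R := \sum_i \sum_j x 0 i * A i j * x 0 j.
Definition sqnorm x : R := \sum_i x 0 i ^+ 2.

Lemma qformE A x : qform A x = (x *m A *m x^T) 0 0.
Proof.
rewrite mxE /qform exchange_big; apply: eq_bigr => j _.
by rewrite !mxE mulr_suml.
Qed.

Lemma sqnormE x : sqnorm x = (x *m x^T) 0 0.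
Proof. by rewrite mxE; apply: eq_bigr => j _; rewrite !mxE expr2. Qed.

Lemma sqnorm_ge0 x : 0 <= sqnorm x.
Proof. by apply: sumr_ge0 => i _; rewrite sqr_ge0. Qed.

Lemma sqnorm_gt0 x : x != 0 -> 0 < sqnorm x.
Proof.
move=> x0; rewrite lt_def sqnorm_ge0 andbT; apply: contra x0.
rewrite psumr_eq0; last by move=> i _; rewrite sqr_ge0.
move/allP => h; apply/eqP/rowP => i; rewrite mxE.
by apply/eqP; rewrite -sqrf_eq0; apply: h; rewrite mem_index_enum.
Qed.

Lemma sqr_le_sqnorm x i : x 0 i ^+ 2 <= sqnorm x.
Proof.
by rewrite /sqnorm (bigD1 i) //= lerDl sumr_ge0 // => j _; rewrite sqr_ge0.
Qed.

Lemma qform_bounded A : exists2 K, 0 < K & forall x, qform A x <= K * sqnorm x.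
Proof.
(* The summand 1 keeps the constant positive even for the zero matrix. *)
exists (1 + \sum_i \sum_j `|A i j|).
  rewrite ltr_pwDl ?ltr01 //.
  by apply: sumr_ge0 => i _; apply: sumr_ge0 => j _; rewrite normr_ge0.
move=> x; apply: (@le_trans _ _ ((\sum_i \sum_j `|A i j|) * sqnorm x)); last first.
  by rewrite ler_wpM2r ?sqnorm_ge0 // lerDr.
rewrite /qform mulr_suml; apply: ler_sum => i _.
rewrite mulr_suml; apply: ler_sum => j _.
have -> : x 0 i * A i j * x 0 j = A i j * (x 0 i * x 0 j) by ring.
by apply: mul_le_norm_of_sqr_le; apply: sqr_le_sqnorm.
Qed.

Lemma qform_scalarB A a x : qform (a%:M - A) x = a * sqnorm x - qform A x.
Proof.
by rewrite !qformE sqnormE mulmxBr mulmxBl mul_mx_scalar -scalemxAl !mxE.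
Qed.

Lemma qform_gram A x : qform (A *m A^T) x = sqnorm (x *m A).
Proof. by rewrite qformE sqnormE trmx_mul !mulmxA. Qed.

(* If B is positive semidefinite and invertible then expanding
   0 <= qform B (x - t *: (x *m B)) for a small t > 0 bounds |x B|^2, hence
   |x|^2, by a multiple of qform B x. *)
Lemma psd_unit_coercive B : B^T = B -> B \in unitmx ->
  (forall x, 0 <= qform B x) ->
  exists2 c, 0 < c & forall x, sqnorm x <= c * qform B x.
Proof.
move=> symB uB psdB.
have [K K0 hK] := qform_bounded B.
(* Evaluated at [x *m B] this form returns [sqnorm x], so [L] bounds |x|^2 by a multiple of |x
   B|^2. *)
have [L L0 hL] := qform_bounded (invmx B *m (invmx B)^T).
exists (L * K); first exact: mulr_gt0.
move=> x; pose y := x *m B.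
have hy : sqnorm y <= K * qform B x.
  (* With t = 1/K the term t^2 [qform B y] is at most t |y|^2, which cancels half of the linear
     term. *)
  have := psdB (x - K^-1 *: y).
  have -> : qform B (x - K^-1 *: y)
      = qform B x - 2 * K^-1 * sqnorm y + K^-1 ^+ 2 * qform B y.
    rewrite !qformE sqnormE.
    have e1 : x *m B *m y^T = y *m y^T by [].
    have e2 : y *m B *m x^T = y *m y^T.
      by rewrite /y trmx_mul symB -!mulmxA.
    have -> : (x - K^-1 *: y)^T = x^T - K^-1 *: y^T by rewrite linearB linearZ.
    rewrite !mulmxBl !mulmxBr -!scalemxAl -!scalemxAr.
    rewrite e1 e2 !mxE; ring.
  have := hK y; have := sqnorm_ge0 y.
  set b := sqnorm y; set a := qform B x; set c := qform B y.
  move=> b0 hc h.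
  have Ki : K * K^-1 = 1 by rewrite divff // gt_eqF.
  have Ki0 : 0 < K^-1 by rewrite invr_gt0.
  have : K^-1 ^+ 2 * c <= K^-1 * b.
    have -> : K^-1 * b = K^-1 ^+ 2 * (K * b) by rewrite expr2; field; rewrite gt_eqF.
    by rewrite ler_pM2l // exprn_gt0.
  move=> h2.
  have : 0 <= a - K^-1 * b by nra.
  by rewrite subr_ge0 mulrC ler_pdivrMr // mulrC.
apply: (le_trans (y := L * sqnorm y)).
  have := hL y; rewrite qform_gram.
  by rewrite /y mulmxK.
by rewrite -mulrA ler_pM2l.
Qed.

End QuadraticForm.

Section Rayleigh.
Local Open Scope ring_scope.
Variables (R : realType) (n : nat).
Implicit Types A : 'M[R]_n.

(** The witness is the supremum of the Rayleigh quotients. Were [(sup S)%:M - A] invertible,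
    coercivity would keep every quotient at least [c^-1] below [sup S], contradicting its minimality
    as an upper bound. *)
Lemma symmetric_max_eigen A : (0 < n)%N -> A^T = A ->
  exists2 a, eigenvalue A a & forall x, qform A x <= a * sqnorm x.
Proof.
move=> n0 symA.
pose S : set R := [set a : R | exists2 x : 'rV[R]_n, x != 0 & qform A x = a * sqnorm x]%classic.
have [K K0 hK] := qform_bounded A.
have ubS : has_ubound S.
  exists K => a [x x0 ha]; have := hK x; rewrite ha ler_pM2r //.
  exact: sqnorm_gt0.
have quot x : x != 0 -> S (qform A x / sqnorm x).
  by move=> x0; exists x => //; rewrite divfK // gt_eqF // sqnorm_gt0.
have neS : (S !=set0)%classic.
  pose u : 'rV[R]_n := const_mx 1.
  exists (qform A u / sqnorm u); apply: quot.
  apply/eqP => /rowP /(_ (Ordinal n0)); rewrite !mxE; apply/eqP.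
  exact: oner_neq0.
have hA x : qform A x <= sup S * sqnorm x.
  have [->|x0] := eqVneq x 0.
    by rewrite qformE sqnormE !mul0mx mxE mulr0.
  rewrite -ler_pdivrMr ?sqnorm_gt0 //; apply: ub_le_sup => //; exact: quot.
exists (sup S) => //.
have [uB|nuB] := boolP ((sup S)%:M - A \in unitmx).
  have symB : ((sup S)%:M - A)^T = (sup S)%:M - A.
    by rewrite linearB /= tr_scalar_mx symA.
  have psdB x : 0 <= qform ((sup S)%:M - A) x.
    by rewrite qform_scalarB subr_ge0.
  have [c c0 hc] := psd_unit_coercive symB uB psdB.
  suff : sup S <= sup S - c^-1.
    by rewrite lerBrDr gerDl leNgt invr_gt0 c0.
  apply: ge_sup => // a [x x0 ha].
  have sx := sqnorm_gt0 x0.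
  have := hc x; rewrite qform_scalarB ha -mulrBl mulrA.
  rewrite -[leLHS]mul1r ler_pM2r // => h.
  by rewrite lerBrDr -lerBrDl -(ler_pM2l c0) divff // gt_eqF.
rewrite /eigenvalue /eigenspace kermx_eq0 row_free_unit.
by rewrite -opprB -scaleN1r unitmxZ ?unitrN1.
Qed.

(** An eigenvalue is the Rayleigh quotient of its eigenvector, so the supremum defining [lambda1] is
    a maximum. *)
Lemma lambda1_symmetric A : (0 < n)%N -> A^T = A ->
  eigenvalue A (lambda1 A) /\ forall x, qform A x <= lambda1 A * sqnorm x.
Proof.
move=> n0 symA; have [a eva ha] := symmetric_max_eigen n0 symA.
suff -> : lambda1 A = a by [].
have uba : ubound [set b : R | eigenvalue A b]%classic a.
  move=> b /eigenvalueP [v vb v0].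
  have := ha v; rewrite qformE vb -scalemxAl mxE -sqnormE ler_pM2r //.
  exact: sqnorm_gt0.
apply/eqP; rewrite eq_le; apply/andP; split.
  by apply: ge_sup => //; exists a.
by apply: ub_le_sup => //; exists a.
Qed.

End Rayleigh.

(** * Distances and the graph kbar *)

Section Distance.
Variable n : nat.
Implicit Types (e : rel 'I_n) (x y z : 'I_n).

Lemma walk_rcons e k x y z : walk e k x y -> e y z -> walk e k.+1 x z.
Proof.
elim: k x => [|k IHk] x.
  by move=> /eqP -> eyz; apply/existsP; exists z; rewrite eyz /=.
case/existsP => u /andP[exu wuy] eyz.
by apply/existsP; exists u; rewrite exu; apply: IHk.
Qed.

Lemma walk_sym e k : symmetric e -> symmetric (walk e k).
Proof.
move=> sym_e; suff walkC x y : walk e k x y -> walk e k y x.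
  by move=> x y; apply/idP/idP; apply: walkC.
elim: k x y => [|k IHk] x y; first by move/eqP ->; apply: eqxx.
case/existsP => u /andP[exu wuy]; apply: (walk_rcons (IHk _ _ wuy)).
by rewrite sym_e.
Qed.

Lemma gdist_sym e : symmetric e -> commutative (gdist e).
Proof. by move=> sym_e x y; apply: eq_find => k; apply: walk_sym. Qed.

Lemma gdist_le e k x y : (k < n)%N -> walk e k x y -> (gdist e x y <= k)%N.
Proof.
move=> kn wk; rewrite leqNgt; apply/negP => /(before_find 0%N).
by rewrite nth_iota // add0n wk.
Qed.

(** A failed [find] returns n, so a value below n certifies a walk. *)
Lemma walk_gdist e x y : (gdist e x y < n)%N -> walk e (gdist e x y) x y.
Proof.
move=> lt_n; have := lt_n; rewrite -[X in (_ < X)%N](size_iota 0) -has_find.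
by move/(nth_find 0%N); rewrite nth_iota.
Qed.

Definition nonadj e x y := (x != y) && ~~ e x y.

(** Value 0 forces equality and value 1 forces an edge; the default value n is covered by
    [2 <= n]. *)
Lemma nonadj_gdist e x y : (2 <= n)%N ->
  ((x != y) + nonadj e x y <= gdist e x y)%N.
Proof.
move=> n2; have [lt_n|ge_n] := ltnP (gdist e x y) n; last first.
  apply: leq_trans (leq_trans n2 ge_n); rewrite /nonadj.
  by case: (x != y); case: (e x y).
have := walk_gdist lt_n; rewrite /nonadj.
case: (gdist e x y) => [/= /eqP ->|[/existsP[z /andP[exz /eqP <-]]|d _]].
- by rewrite eqxx.
- by rewrite exz andbF; case: (x != z).
- by case: (x != y); case: (e x y).
Qed.

(** Vertex 0 is a common neighbour of any two distinct non-adjacent vertices, so the general lower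
    bound is attained. *)
Lemma gdist_kbar x y : (3 <= n)%N ->
  gdist (kbar n) x y = ((x != y) + nonadj (kbar n) x y)%N.
Proof.
move=> n3; apply/eqP; rewrite eqn_leq nonadj_gdist ?andbT; last exact: ltnW.
rewrite /nonadj; have [->|xy] := eqVneq x y; first by apply: gdist_le; [lia|apply: eqxx].
case: (boolP (kbar n x y)) => [kxy|nkxy]; (apply: gdist_le; first lia).
  by apply/existsP; exists y; rewrite kxy /=.
have n0 : (0 < n)%N by lia.
apply/existsP; exists (Ordinal n0); apply/andP; split.
  move: nkxy; rewrite /kbar xy /= !negb_or -val_eqE /= => /and3P[x0 _ _].
  by rewrite orbT andbT.
apply/existsP; exists y; rewrite /= eqxx andbT.
move: nkxy; rewrite /kbar xy /= !negb_or -val_eqE /= => /and3P[_ y0 _].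
by rewrite eq_sym y0.
Qed.

End Distance.

Section DistanceForm.
Local Open Scope ring_scope.
Variables (R : realType) (n : nat).
Implicit Types (e : rel 'I_n) (x : 'rV[R]_n).

Lemma distmx_sym e : symmetric e -> (distmx R e)^T = distmx R e.
Proof. by move=> se; apply/matrixP => i j; rewrite !mxE gdist_sym. Qed.

Lemma complete_formE x :
  \sum_i \sum_j x 0 i * (i != j)%:R * x 0 j = (\sum_i x 0 i) ^+ 2 - sqnorm x.
Proof.
rewrite expr2 mulr_suml /sqnorm -sumrB; apply: eq_bigr => i _.
rewrite mulr_sumr (bigD1 i) //= [in RHS](bigD1 i) //= eqxx mulr0 mul0r add0r.
rewrite -expr2 addrAC subrr add0r.
by apply: eq_bigr => j /negPf ji; rewrite eq_sym ji mulr1.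
Qed.

(** Entrywise, the distance matrix dominates J - I plus the non-adjacency matrix. A nonnegative
    vector carries this over to quadratic forms, and the -I becomes the [+ 1]. *)
Lemma lambda1_ge e x : (2 <= n)%N -> symmetric e -> (forall i, 0 <= x 0 i) ->
  (\sum_i x 0 i) ^+ 2 + \sum_i \sum_j x 0 i * (nonadj e i j)%:R * x 0 j
  <= (lambda1 (distmx R e) + 1) * sqnorm x.
Proof.
move=> n2 se x0; have n0 : (0 < n)%N by apply: leq_trans n2.
have [_ /(_ x)] := lambda1_symmetric n0 (distmx_sym se).
rewrite mulrDl mul1r -lerBlDr; apply: le_trans.
rewrite addrAC -complete_formE -big_split; apply: ler_sum => i _.
rewrite -big_split; apply: ler_sum => j _ /=.
rewrite mxE -mulrDl -mulrDr ler_wpM2r // ler_wpM2l // -natrD ler_nat.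
exact: nonadj_gdist.
Qed.

End DistanceForm.

(** * The largest distance eigenvalue of [kbar] and its eigenvector *)

Section Kbar.
Local Open Scope ring_scope.
Variables (R : realType) (m : nat).
Hypothesis m_gt0 : (0 < m)%N.
Local Notation n := m.+2.
Local Notation D := (distmx R (kbar n)).
Implicit Types v : 'rV[R]_n.

Let rho := lambda1 D.

Lemma kbar_sym : symmetric (kbar n).
Proof.
move=> i j; rewrite /kbar eq_sym; congr (_ && _).
by rewrite orbCA; congr [|| _, _ | _]; rewrite andbC.
Qed.

Lemma nonadj_kbar (i j : 'I_n) : nonadj (kbar n) i j =
  [&& i != j, i != ord0, j != ord0 & (i == ord_max) || (j == ord_max)].
Proof.
rewrite /nonadj /kbar -!val_eqE /=.
by case: (_ == _ :> nat); rewrite //= !negb_or negb_and !negbK.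
Qed.

Lemma sum_kbar v : \sum_i v 0 i =
  v 0 ord0 + v 0 ord_max + \sum_(i | (i != ord0) && (i != ord_max)) v 0 i.
Proof. by rewrite (bigD1 ord0) //= (bigD1 ord_max) //= addrA. Qed.

Lemma sum_kbar_const (c : R) :
  \sum_(i < n | (i != ord0) && (i != ord_max)) c = m%:R * c.
Proof.
have := sum_kbar (const_mx c); under eq_bigr do rewrite mxE.
rewrite !mxE sumr_const card_ord; under eq_bigr do rewrite mxE.
set P := \sum_(i | _) _ => h.
have -> : P = c *+ n - (c + c) by rewrite h; ring.
by rewrite mulr_natl !mulrS; ring.
Qed.

Lemma distmx_kbar_mulE v j : (v *m D) 0 j =
  \sum_i v 0 i - v 0 j + \sum_i v 0 i * (nonadj (kbar n) i j)%:R.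
Proof.
rewrite mxE [\sum_i v 0 i](bigD1 j) //= [v 0 j + _]addrC addrK.
have -> : \sum_(i | i != j) v 0 i = \sum_i v 0 i * (i != j)%:R.
  by rewrite big_mkcond; apply: eq_bigr => i _; case: (i != j); rewrite ?mulr1 ?mulr0.
rewrite -big_split; apply: eq_bigr => i _ /=.
by rewrite mxE gdist_kbar // natrD mulrDr.
Qed.

Section Eigenvector.
Variables (v : 'rV[R]_n) (a : R).
Hypothesis eigv : v *m D = a *: v.
Let T := \sum_i v 0 i.
Let X := a + 1.

(** The shift X = a + 1 absorbs the -I in D = J - I + N. The non-adjacency matrix N only links the
    pendant vertex with the clique, so the three cases below stay short. *)
Lemma kbar_eig j : X * v 0 j = T + \sum_i v 0 i * (nonadj (kbar n) i j)%:R.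
Proof.
have := distmx_kbar_mulE v j; rewrite eigv mxE /X mulrDl mul1r => ->.
by rewrite /T; ring.
Qed.

Lemma kbar_eig_center : X * v 0 ord0 = T.
Proof.
rewrite kbar_eig big1 ?addr0 // => i _.
by rewrite nonadj_kbar eqxx !andbF mulr0.
Qed.

Lemma kbar_eig_pendant :
  X * v 0 ord_max = T + \sum_(i | (i != ord0) && (i != ord_max)) v 0 i.
Proof.
rewrite kbar_eig; congr (_ + _); rewrite [RHS]big_mkcond; apply: eq_bigr => i _.
rewrite nonadj_kbar eqxx orbT andbT andbC /=.
by case: (i != ord0); case: (i != ord_max); rewrite ?mulr1 ?mulr0.
Qed.

Lemma kbar_eig_clique j : j != ord0 -> j != ord_max ->
  X * v 0 j = T + v 0 ord_max.
Proof.
move=> j0 jm; rewrite kbar_eig (bigD1 ord_max) //= nonadj_kbar j0 eqxx eq_sym jm.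
rewrite mulr1 big1 ?addr0 // => i /negPf im.
by rewrite nonadj_kbar im (negPf jm) !andbF mulr0.
Qed.

Hypothesis X_gt0 : 0 < X.
Hypothesis X2_gt : m%:R < X ^+ 2.

(** With p the pendant entry, the clique sum P satisfies X P = m (T + p) and P = X p - T;
    eliminating P gives the relation. *)
Lemma kbar_eig_pendantE : v 0 ord_max * (X ^+ 2 - m%:R) = T * (m%:R + X).
Proof.
have hp := kbar_eig_pendant; set P := \sum_(i | _) _ in hp.
have hP : X * P = m%:R * (T + v 0 ord_max).
  rewrite mulr_sumr -sum_kbar_const; apply: eq_bigr => j /andP[j0 jm].
  exact: kbar_eig_clique.
have eP : P = X * v 0 ord_max - T by rewrite hp; ring.
rewrite eP in hP.
have -> : v 0 ord_max * (X ^+ 2 - m%:R)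
    = X * (X * v 0 ord_max - T) + X * T - m%:R * v 0 ord_max by ring.
by rewrite hP; ring.
Qed.

(** If T = 0, then X^2 > m kills the pendant entry, and the remaining equations kill all the
    others. *)
Lemma kbar_eig_sum : v != 0 -> T != 0.
Proof.
apply: contraNneq => T0; apply/eqP/rowP => j; rewrite mxE.
have X0 : X != 0 by rewrite gt_eqF.
have vmax : v 0 ord_max = 0.
  have := kbar_eig_pendantE; rewrite T0 mul0r => /eqP.
  by rewrite mulf_eq0 subr_eq0 [X ^+ 2 == _]gt_eqF // orbF => /eqP.
apply: (mulfI X0); rewrite mulr0.
have [->|j0] := eqVneq j ord0; first by rewrite kbar_eig_center.
have [->|jm] := eqVneq j ord_max; first by rewrite vmax mulr0.
by rewrite kbar_eig_clique // T0 vmax addr0.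
Qed.

(** Summing all entries gives (2 X - 1) T = (X + X^2) p. Eliminating p with [kbar_eig_pendantE] and
    cancelling T leaves the cubic. *)
Lemma kbar_charpoly : v != 0 ->
  X ^+ 3 - n%:R * X ^+ 2 - 3 * m%:R * X + m%:R = 0.
Proof.
move=> v0; have T0 := kbar_eig_sum v0.
have h0 := kbar_eig_center; have hp := kbar_eig_pendant.
have hq := kbar_eig_pendantE; have hT : T = _ := sum_kbar v.
set P := \sum_(i | _) _ in hp hT.
have -> : n%:R = m%:R + 2 :> R by rewrite -addn2 natrD.
apply: (mulfI T0); rewrite mulr0.
have e1 : X * T = T + X * v 0 ord_max + X * (X * v 0 ord_max - T).
  have -> : X * v 0 ord_max - T = P by rewrite hp; ring.
  by rewrite {1}hT !mulrDr h0.
have e2 : (2 * X - 1) * T = v 0 ord_max * (X + X ^+ 2).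
  have -> : (2 * X - 1) * T = X * T + X * T - T by ring.
  by rewrite {1}e1; ring.
have e3 : (2 * X - 1) * T * (X ^+ 2 - m%:R) = T * (m%:R + X) * (X + X ^+ 2).
  by rewrite e2 -hq; ring.
transitivity ((2 * X - 1) * T * (X ^+ 2 - m%:R)
  - T * (m%:R + X) * (X + X ^+ 2)); first by ring.
by rewrite e3 subrr.
Qed.

(** Every entry is T times a positive factor. Hence one of [v] and [- v] is a Perron vector. *)
Lemma kbar_eig_gt0 j : 0 < T -> 0 < v 0 j.
Proof.
move=> T0.
have vmax : 0 < v 0 ord_max.
  rewrite -(@pmulr_lgt0 _ (X ^+ 2 - m%:R)) ?subr_gt0 // kbar_eig_pendantE.
  by rewrite mulr_gt0 // ltr_wpDl.
rewrite -(pmulr_rgt0 _ X_gt0).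
have [->|j0] := eqVneq j ord0; first by rewrite kbar_eig_center.
have [->|jm] := eqVneq j ord_max; first by rewrite mulr_gt0.
by rewrite kbar_eig_clique // addr_gt0.
Qed.

End Eigenvector.

(** The all-ones test vector gives this bound, which puts [rho + 1] in the range required by [X_gt0]
    and [X2_gt]. *)
Lemma kbar_lambda1_ge : n%:R <= rho + 1.
Proof.
pose u : 'rV[R]_n := const_mx 1.
have u0 i : 0 <= u 0 i by rewrite mxE.
have := lambda1_ge (isT : (2 <= n)%N) kbar_sym u0.
have -> : \sum_i u 0 i = n%:R.
  by under eq_bigr do rewrite mxE; rewrite sumr_const card_ord.
have -> : sqnorm u = n%:R.
  rewrite /sqnorm; under eq_bigr do rewrite mxE expr1n.
  by rewrite sumr_const card_ord.
rewrite expr2 => h; rewrite -(@ler_pM2r _ n%:R) ?ltr0n //.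
apply: le_trans h; rewrite lerDl; apply: sumr_ge0 => i _; apply: sumr_ge0 => j _.
by rewrite !mulr_ge0.
Qed.

Lemma kbar_lambda1_gt0 : 0 < rho + 1.
Proof. by apply: lt_le_trans kbar_lambda1_ge; rewrite ltr0n. Qed.

Lemma kbar_lambda1_sqr : m%:R < (rho + 1) ^+ 2.
Proof.
apply: (lt_le_trans (y := n%:R ^+ 2)).
  by rewrite -natrX ltr_nat; nia.
by rewrite lerXn2r ?nnegrE ?ler0n ?kbar_lambda1_ge // ltW // kbar_lambda1_gt0.
Qed.

Lemma kbar_eigenvector : exists2 v : 'rV[R]_n, v *m D = rho *: v & v != 0.
Proof.
have [ev _] := @lambda1_symmetric R n D isT (distmx_sym R kbar_sym).
exact/eigenvalueP.
Qed.

Lemma kbar_lambda1_root :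
  (rho + 1) ^+ 3 - n%:R * (rho + 1) ^+ 2 - 3 * m%:R * (rho + 1) + m%:R = 0.
Proof.
have [v eigv v0] := kbar_eigenvector.
exact: kbar_charpoly eigv kbar_lambda1_gt0 kbar_lambda1_sqr v0.
Qed.

Lemma kbar_perron_vector :
  exists2 v : 'rV[R]_n, v *m D = rho *: v & forall i, 0 < v 0 i.
Proof.
have [v eigv v0] := kbar_eigenvector.
have := kbar_eig_sum eigv kbar_lambda1_gt0 kbar_lambda1_sqr v0.
rewrite neq_lt => /orP[T0|T0].
  exists (- v); first by rewrite mulNmx eigv scalerN.
  move=> i; apply: (@kbar_eig_gt0 _ rho) kbar_lambda1_gt0 kbar_lambda1_sqr _ _.
    by rewrite mulNmx eigv scalerN.
  by under eq_bigr do rewrite mxE; rewrite sumrN oppr_gt0.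
exists v => // i.
exact: kbar_eig_gt0 eigv kbar_lambda1_gt0 kbar_lambda1_sqr _ T0.
Qed.

(** The cubic is nondecreasing on [n, oo): its difference quotient is X (X - n) + Y (Y - n) + (X Y -
    3 m), and 3 m <= n^2 <= X Y. So a positive value at Y places Y beyond the root. *)
Lemma kbar_lambda1_lt (Y : R) : n%:R <= Y ->
  0 < Y ^+ 3 - n%:R * Y ^+ 2 - 3 * m%:R * Y + m%:R -> rho + 1 < Y.
Proof.
move=> nY gY; rewrite ltNge; apply/negP => YX.
have := kbar_lambda1_root; move: (rho + 1) YX => X YX gX.
suff : 0 <= (X - Y) * (X * (X - n%:R) + Y * (Y - n%:R) + (X * Y - 3 * m%:R)).
  by move: gY gX; move: (n%:R : R) (m%:R : R) => N M; nra.
have n0 : 0 <= n%:R :> R by rewrite ler0n.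
have nX := le_trans nY YX; have Y0 := le_trans n0 nY; have X0 := le_trans n0 nX.
have XY : 3 * m%:R <= X * Y; last first.
  by rewrite mulr_ge0 ?subr_ge0 // -addrA 2?addr_ge0 ?mulr_ge0 ?subr_ge0.
apply: (le_trans (y := n%:R * n%:R)); last by apply: ler_pM.
by rewrite -!natrM ler_nat; nia.
Qed.

End Kbar.

(** * Test vectors *)

(** Ordered pairs are counted: for symmetric [e] this is twice the number of edges of the
    complement. *)
Definition nonadj_count n (e : rel 'I_n) : nat :=
  \sum_x #|[set y | nonadj e x y]|.

Section TestVectors.
Local Open Scope ring_scope.
Variables (R : realType) (m : nat).
Hypothesis m_gt0 : (0 < m)%N.
Local Notation n := m.+2.
Variable e : rel 'I_n.
Hypothesis sym_e : symmetric e.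

(** The test vector is the Perron vector of [kbar] pulled back along [f]. Distances can only grow,
    they grow strictly at [(x0, y0)], and positive entries keep the inequality strict. *)
Lemma kbar_spanning_subgraph_lambda1 (f : {perm 'I_n}) (x0 y0 : 'I_n) :
  (forall x y, e x y -> kbar n (f x) (f y)) ->
  kbar n (f x0) (f y0) -> ~~ e x0 y0 ->
  lambda1 (distmx R (kbar n)) < lambda1 (distmx R e).
Proof.
move=> sub_f k0 ne0; have [v eigv v0] := kbar_perron_vector R m_gt0.
set r := lambda1 _ in eigv *.
pose z : 'rV[R]_n := \row_i v 0 (f i).
have [_ /(_ z)] := lambda1_symmetric (ltn0Sn m.+1) (@distmx_sym R _ _ sym_e).
have zv : sqnorm z = sqnorm v.
  rewrite /sqnorm [RHS](reindex_perm f).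
  by apply: eq_bigr => i _; rewrite mxE.
have sv : 0 < sqnorm v.
  apply: sqnorm_gt0; apply/eqP => /rowP /(_ ord0).
  by rewrite mxE; apply/eqP; rewrite gt_eqF.
move=> h; rewrite -(ltr_pM2r sv) -zv; apply: lt_le_trans h.
have -> : r * sqnorm z = qform (distmx R (kbar n)) v.
  by rewrite zv qformE eigv -scalemxAl mxE sqnormE.
rewrite /qform [ltLHS](reindex_perm f) /=.
under eq_bigr do rewrite (reindex_perm f) /=.
rewrite !pair_big /=.
rewrite [ltLHS](bigD1 (x0, y0)) //= [ltRHS](bigD1 (x0, y0)) //=.
have nonadj_f x y : nonadj (kbar n) (f x) (f y) -> nonadj e x y.
  case/andP=> fxy nk; rewrite /nonadj -(inj_eq (@perm_inj _ f)) fxy /=.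
  by apply: contra nk; apply: sub_f.
apply: ltr_leD.
  rewrite !mxE ltr_pM2r // ltr_pM2l // ltr_nat gdist_kbar //.
  have x0y0 : x0 != y0 by move: k0; rewrite /kbar (inj_eq perm_inj) => /andP[].
  apply: leq_trans (nonadj_gdist _ _ _ _) => //.
  by rewrite /nonadj (inj_eq perm_inj) k0 ne0 x0y0.
apply: ler_sum => -[x y] _ /=; rewrite !mxE ler_pM2r // ler_pM2l // ler_nat gdist_kbar //.
apply: leq_trans (nonadj_gdist _ _ _ _) => //.
rewrite (inj_eq perm_inj) leq_add2l; have := nonadj_f x y.
by case: nonadj => // ->.
Qed.

(* The numeric condition makes the cubic of [kbar_lambda1_lt] positive at
   [n + E / n]. *)
Lemma all_ones_lambda1 (E : nat) : (3 <= m)%N -> (E <= nonadj_count e)%N ->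
  (3 * m * n ^ 2 <= E * (n ^ 2 + E) + 3)%N ->
  lambda1 (distmx R (kbar n)) < lambda1 (distmx R e).
Proof.
move=> m3 leE hE; pose u : 'rV[R]_n := const_mx 1.
have u0 i : 0 <= u 0 i by rewrite mxE.
have := lambda1_ge (isT : (2 <= n)%N) sym_e u0.
have -> : \sum_i u 0 i = n%:R.
  by under eq_bigr do rewrite mxE; rewrite sumr_const card_ord.
have -> : sqnorm u = n%:R.
  rewrite /sqnorm; under eq_bigr do rewrite mxE expr1n.
  by rewrite sumr_const card_ord.
have -> : \sum_i \sum_j u 0 i * (nonadj e i j)%:R * u 0 j = (nonadj_count e)%:R.
  rewrite natr_sum; apply: eq_bigr => i _.
  rewrite -sum1_card natr_sum [RHS]big_mkcond; apply: eq_bigr => j _.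
  by rewrite !mxE mul1r mulr1 inE; case: nonadj.
have {leE} : E%:R <= (nonadj_count e)%:R :> R by rewrite ler_nat.
move: ((nonadj_count e)%:R) => N leE le_l1.
have n0 : 0 < n%:R :> R by rewrite ltr0n.
have : n%:R + E%:R / n%:R <= lambda1 (distmx R e) + 1.
  rewrite -(ler_pM2r n0) mulrDl divfK ?gt_eqF // -expr2.
  by apply: le_trans le_l1; rewrite lerD2l.
move=> h; rewrite -(ltrD2r 1); apply: lt_le_trans h.
apply: kbar_lambda1_lt => //; first by rewrite lerDl divr_ge0.
set d := E%:R / n%:R.
have d0 : 0 <= d by rewrite divr_ge0.
have hN : n%:R = m%:R + 2 :> R by rewrite -addn2 natrD.
have mr3 : 3 <= m%:R :> R by rewrite ler_nat.
have hd : 3 * m%:R * n%:R ^+ 2 <= (d * (n%:R + d)) * n%:R ^+ 2 + 3.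
  have -> : d * (n%:R + d) * n%:R ^+ 2 = E%:R * (n%:R ^+ 2 + E%:R).
    have <- : d * n%:R = E%:R by rewrite /d divfK // gt_eqF.
    ring.
  by rewrite -!natrX -!natrD -!natrM -natrD ler_nat.
move: n0 mr3 d0 hd; rewrite hN; move: (m%:R : R) d => M d n0 mr3 d0 hd.
have -> : (M + 2 + d) ^+ 3 - (M + 2) * (M + 2 + d) ^+ 2 - 3 * M * (M + 2 + d) + M
   = (M + 2 + d) * (d * (M + 2 + d) - 3 * M) + M by ring.
(* The slack 3 in the hypothesis allows w to be slightly negative, but not below -3 / (M + 2)^2, and
   the final summand M outweighs this. *)
set w := d * (M + 2 + d) - 3 * M.
have hw : - 3 <= w * (M + 2) ^+ 2 by rewrite /w; lra.
have [w0|w0] := leP 0 w.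
  by rewrite ltr_wpDl ?mulr_ge0 //; lra.
have d3 : d < 3.
  rewrite ltNge; apply/negP => d3; move: w0; rewrite /w; nra.
have h1 : (M + 2 + d) * w * (M + 2) ^+ 2 >= (M + 2 + d) * - 3.
  by rewrite -mulrA ler_pM2l //; lra.
have h2 : 0 < ((M + 2 + d) * w + M) * (M + 2) ^+ 2.
  by rewrite mulrDl; nra.
by move: h2; rewrite pmulr_lgt0 // exprn_gt0.
Qed.

End TestVectors.

Section FiveVertices.
Local Open Scope ring_scope.
Variables (R : realType) (e : rel 'I_5).
Hypothesis sym_e : symmetric e.

(* The all-ones vector is too weak here: [K_2 \/ 3 K_1] and [kbar 5] have the
   same number of edges. *)
Lemma independent3_lambda1 (I : {set 'I_5}) : #|I| = 3%N ->
  {in I &, forall x y, ~~ e x y} ->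
  lambda1 (distmx R (kbar 5)) < lambda1 (distmx R e).
Proof.
move=> cI indI.
(* As in the Perron vector of K_2 \/ 3 K_1, entries on [I] are larger. The sum is 18, the squared
   norm 66, and the six ordered pairs in [I] add 6 * 16 = 96, whence the quotient (324 + 96) / 66 =
   70 / 11. *)
pose z : 'rV[R]_5 := \row_i (if i \in I then 4 else 3).
have z0 i : 0 <= z 0 i by rewrite mxE; case: ifP.
have cI' : #|~: I| = 2%N by apply/eqP; rewrite -(eqn_add2l #|I|) cardsC card_ord cI.
have sumz (F : R -> R) : \sum_i F (z 0 i) = 3 * F 4 + 2 * F 3.
  rewrite (bigID (mem I)) /= (eq_bigr (fun=> F 4)); last first.
    by move=> i iI; rewrite mxE iI.
  rewrite [X in _ + X](eq_bigr (fun=> F 3)); last first.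
    by move=> i /negPf iI; rewrite mxE iI.
  rewrite !sumr_const cI !mulr_natl; congr (_ + _ *+ _).
  by apply: etrans cI'; apply: eq_card => i; rewrite !inE.
have := lambda1_ge (isT : (2 <= 5)%N) sym_e z0.
rewrite (sumz id) /sqnorm (sumz (fun x => x ^+ 2)).
have : 96 <= \sum_i \sum_j z 0 i * (nonadj e i j)%:R * z 0 j.
  have -> : 96 = \sum_(i in I) \sum_(j in I | j != i) (16 : R).
    rewrite (eq_bigr (fun=> 32)) ?sumr_const ?cI; first by ring.
    move=> i iI; rewrite sumr_const.
    have -> : #|[pred j | (j \in I) && (j != i)]| = 2%N.
      have := cardsD1 i I; rewrite cI iI => -[/esym cIi].
      by apply: etrans cIi; apply: eq_card => j; rewrite !inE andbC.
    by ring.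
  rewrite [leRHS](bigID (mem I)) /= ler_wpDr //.
    by apply: sumr_ge0 => i _; apply: sumr_ge0 => j _; rewrite !mulr_ge0.
  apply: ler_sum => i iI.
  rewrite [leRHS](bigID (fun j => (j \in I) && (j != i))) /= ler_wpDr //.
    by apply: sumr_ge0 => j _; rewrite !mulr_ge0.
  apply: ler_sum => j /andP[jI ji].
  by rewrite !mxE iI jI /nonadj eq_sym ji indI //= mulr1 -natrM.
have := @kbar_lambda1_lt R 3 isT (70 / 11).
set N := \sum_i _; move: (lambda1 _) (lambda1 _) => r l.
have h1 : (5%:R : R) <= 70 / 11 by lra.
have h2 : 0 < (70 / 11) ^+ 3 - 5%:R * (70 / 11) ^+ 2 - 3 * 3%:R * (70 / 11) + 3%:R :> R by lra.
move=> /(_ h1 h2) h3 h4 h5; lra.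
Qed.

End FiveVertices.

(** * Components and isolated vertices outside a barrier *)

Section Barriers.
Variables (n : nat) (e : rel 'I_n) (S : {set 'I_n}).
Hypothesis sym_e : symmetric e.

(** The set whose cardinality is [iso_vertices], by conversion. *)
Definition isolated : {set 'I_n} :=
  [set v in ~: S | [forall u in ~: S, ~~ e v u]].

Local Notation i := #|isolated|.
Local Notation q := (odd_comps e S).

Lemma isolatedP v u : v \in isolated -> u \notin S -> ~~ e v u.
Proof.
by rewrite !inE => /andP[_ /forallP h] uS; have := h u; rewrite inE uS.
Qed.

Lemma isolated_sub : isolated \subset ~: S.
Proof. by apply/fintype.subsetP => v; rewrite inE => /andP[]. Qed.

Lemma del_rel_sym : symmetric (del_rel e S).
Proof. by move=> x y; rewrite /del_rel sym_e [X in _ && X]andbC. Qed.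

Lemma components_partition : finset.partition (components e S) (~: S).
Proof.
apply: (@equivalence_partitionP _ (connect (del_rel e S))) => x y z _ _ _.
split; first exact: connect0.
by move=> xy; apply: (same_connect (sym_connect_sym del_rel_sym) xy).
Qed.

Lemma comp_of_isolated v : v \in isolated -> comp_of e S v = [set v].
Proof.
move=> vI; apply/finset.setP => u; rewrite !inE; apply/andP/eqP => [[uS /connectP[p]]|->].
  case: p => [_ -> //|w p /= /andP[/and3P[evw _ wS] _] _].
  by have := isolatedP vI wS; rewrite evw.
by split; [have := fintype.subsetP isolated_sub v vI; rewrite inE|apply: connect0].
Qed.

Lemma components_card (P : {set {set 'I_n}}) :
  P \subset components e S -> (\sum_(C in P) #|C| <= #|~: S|)%N.
Proof.
move=> sP; rewrite (card_partition components_partition).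
rewrite [leqRHS](big_setID P) /= (finset.setIidPr sP); exact: leq_addr.
Qed.

(** A lower bound on component sizes with total 3 q + i; its cap 3 limits the loss when one
    component is left out. *)
Let weight (C : {set 'I_n}) : nat :=
  3 * (odd #|C| && (3 <= #|C|)) + (C \in [set [set v] | v in isolated]).

Let weight_le (C : {set 'I_n}) : (weight C <= #|C|)%N /\ (weight C <= 3)%N.
Proof.
rewrite /weight; case: imsetP => [[v _ ->]|_]; first by rewrite cards1.
by case: andP => [[_ ->]|_].
Qed.

Let sum_weight : \sum_(C in components e S) weight C = 3 * q + i.
Proof.
rewrite big_split /= -big_distrr /=; congr (_ * _ + _).
  rewrite /odd_comps -sum1_card big_mkcond [RHS]big_mkcond /=.
  by apply: eq_bigr => C _; rewrite inE; case: (C \in _) => //=; case: (_ && _).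
rewrite -(card_imset _ (@set1_inj _)) -sum1_card big_mkcond [RHS]big_mkcond /=.
apply: eq_bigr => C _.
have [/imsetP[v vI ->]|_] := boolP (C \in [set [set v] | v in isolated]).
  rewrite -comp_of_isolated // imset_f //.
  exact: (fintype.subsetP isolated_sub).
by case: ifP.
Qed.

Lemma card_components_ge : (3 * q + i <= #|~: S|)%N.
Proof.
rewrite -sum_weight; apply: leq_trans (components_card (subxx _)).
by apply: leq_sum => C _; case: (weight_le C).
Qed.

(** All vertices outside [S] and outside the component of [v] are non-adjacent to [v]; discarding
    that component costs weight at most 3. *)
Lemma card_other_components v : v \notin S ->
  (3 * q + i - 3 <= #|[set y | nonadj e v y]|)%N.
Proof.
move=> vS; have vD : v \in ~: S by rewrite inE.
have Cv : comp_of e S v \in components e S by apply: imset_f.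
apply: (@leq_trans #|~: S :\: comp_of e S v|); last first.
  apply: subset_leq_card; apply/fintype.subsetP => y; rewrite !inE => /andP[h yS].
  move: h; rewrite yS /= /nonadj => h; apply/andP; split.
    by apply: contraNneq h => ->; apply: connect0.
  apply: contra h => evy; apply: connect1.
  by rewrite /del_rel evy vS.
rewrite cardsD (finset.setIidPr _); last by apply/fintype.subsetP => y; rewrite inE => /andP[].
rewrite (card_partition components_partition) (bigD1 _ Cv) /= addKn.
rewrite -sum_weight (bigD1 _ Cv) /= leq_subLR.
apply: leq_add; first by case: (weight_le (comp_of e S v)).
by apply: leq_sum => C _; case: (weight_le C).
Qed.

Lemma nonadj_isolated v : v \in isolated ->
  (n - #|S| - 1 <= #|[set y | nonadj e v y]|)%N.
Proof.
move=> vI; have vS : v \in ~: S := fintype.subsetP isolated_sub v vI.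
have <- : #|(~: S) :\ v| = (n - #|S| - 1)%N.
  by have := cardsD1 v (~: S); rewrite vS; have := cardsC S; rewrite card_ord; lia.
apply: subset_leq_card; apply/fintype.subsetP => y; rewrite !inE => /andP[yv yS].
by rewrite /nonadj eq_sym yv isolatedP.
Qed.

Lemma nonadj_to_isolated v : v \notin S -> v \notin isolated ->
  (i <= #|[set y | nonadj e v y]|)%N.
Proof.
move=> vS vI; apply: subset_leq_card; apply/fintype.subsetP => y yI.
rewrite inE /nonadj sym_e isolatedP // andbT.
by apply: contraNneq vI => ->.
Qed.

End Barriers.

(** * Barrier inequality and counts of non-adjacent pairs *)

Lemma odd_comps_set0 n (e : rel 'I_n) : odd n -> (3 <= n)%N ->
  connected_graph e -> (1 <= odd_comps e finset.set0)%N.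
Proof.
move=> oddn n3 conn_e; have n0 : (0 < n)%N by apply: leq_trans n3.
(* By connectedness the whole vertex set is a component, and its order is odd and at least 3. *)
pose v := Ordinal n0; apply/card_gt0P; exists [set: 'I_n].
rewrite inE cardsT card_ord oddn n3 /= andbT; apply/imsetP; exists v.
  by rewrite !inE.
apply/finset.setP => u; rewrite !inE /=.
rewrite (@eq_connect _ _ e) ?conn_e // => x y.
by rewrite /del_rel !inE !andbT.
Qed.

(** The barrier is compared with the empty set, whose value is at least 1; this makes the inequality
    strict. *)
Lemma k_barrier_ineq k n (e : rel 'I_n) (S : {set 'I_n}) :
  odd k -> odd n -> (3 <= n)%N -> connected_graph e -> k_barrier k e S ->
  (k * #|S| < odd_comps e S + k * #|isolated e S|)%N.
Proof.
move=> oddk oddn n3 conn_e /(_ finset.set0); rewrite /bt_val oddk cards0 muln0.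
have := odd_comps_set0 oddn n3 conn_e.
rewrite -[iso_vertices e S]/#|isolated e S|.
by move: (iso_vertices _ _) (odd_comps _ _) => a b; lia.
Qed.

(** Isolated vertices miss everything else outside [S], and the other vertices outside [S] miss all
    isolated ones; rows indexed by [S] are dropped. *)
Lemma nonadj_count_isolated n (e : rel 'I_n) (S : {set 'I_n}) : symmetric e ->
  (#|isolated e S| * (n - #|S| - 1)
    + (n - #|S| - #|isolated e S|) * #|isolated e S| <= nonadj_count e)%N.
Proof.
move=> sym_e; rewrite /nonadj_count (bigID (mem (isolated e S))) /=.
apply: leq_add.
  rewrite -sum_nat_const; apply: leq_sum => v; exact: nonadj_isolated.
rewrite [leqRHS](bigID (mem S)) /=; apply: leq_trans (leq_addl _ _).
have -> : (n - #|S| - #|isolated e S|)%N = #|~: S :\: isolated e S|.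
  rewrite cardsD (finset.setIidPr (isolated_sub e S)).
  by have := cardsC S; rewrite card_ord; lia.
rewrite -sum_nat_const [leqLHS](eq_bigl (fun v => (v \notin isolated e S) && (v \notin S))).
  by apply: leq_sum => v /andP[vI vS]; apply: nonadj_to_isolated.
by move=> v; rewrite finset.in_setD finset.in_setC.
Qed.

Lemma nonadj_count_components n (e : rel 'I_n) (S : {set 'I_n}) :
  symmetric e ->
  ((n - #|S|) * (3 * odd_comps e S + #|isolated e S| - 3) <= nonadj_count e)%N.
Proof.
move=> sym_e; have -> : (n - #|S|)%N = #|~: S|.
  by have := cardsC S; rewrite card_ord; lia.
rewrite -sum_nat_const /nonadj_count [leqRHS](bigID (mem S)) /=.
apply: leq_trans (leq_addl _ _).
rewrite [leqLHS](eq_bigl (fun v => v \notin S)); last by move=> v; rewrite inE.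
by apply: leq_sum => v; apply: card_other_components.
Qed.

(** * Barriers consisting of one cut vertex *)

Lemma move_to_kbar_ends m (c p : 'I_m.+2) : c != p ->
  exists f : {perm 'I_m.+2}, f c = ord0 /\ f p = ord_max.
Proof.
(* The first transposition sends [c] to 0; the second sends the image of [p] to the last vertex and
   fixes 0, since that image is not 0. *)
move=> cp; exists (tperm c ord0 * tperm (tperm c ord0 p) ord_max)%g.
rewrite !permM tpermL tpermL; split=> //; apply: tpermD => //.
by rewrite -(inj_eq (@perm_inj _ (tperm c ord0))) tpermK tpermR eq_sym.
Qed.

(** The only possible neighbour of [p] is [c], so relabelling them as pendant vertex and centre
    embeds [e] in [kbar]. Without an isomorphism some edge of [kbar] is missing, and the strict
    comparison applies. *)
Lemma cut_vertex_lambda1 (R : realType) m (e : rel 'I_m.+2) (c p : 'I_m.+2) :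
  (0 < m)%N -> simple_graph e -> ~ graph_iso e (kbar m.+2) ->
  p \in isolated e [set c] ->
  (lambda1 (distmx R (kbar m.+2)) < lambda1 (distmx R e))%R.
Proof.
move=> m0 [sym_e irr_e] niso pI.
have cp : c != p by have := fintype.subsetP (isolated_sub e _) p pI; rewrite !inE eq_sym.
have [f [fc fp]] := move_to_kbar_ends cp.
have p_only x : e p x -> x = c.
  move=> epx; apply/eqP; apply/negPn/negP => xc.
  by have := isolatedP pI (u := x); rewrite inE xc epx => /(_ isT).
have sub_f x y : e x y -> kbar m.+2 (f x) (f y).
  move=> exy; rewrite /kbar; have xy : x != y.
    by apply: contraTneq exy => ->; rewrite irr_e.
  rewrite (inj_eq perm_inj) xy /=.
  have [//|fx0] := boolP (val (f x) == 0%N).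
  have [//|fy0] := boolP (val (f y) == 0%N); rewrite /=.
  apply/andP; split; [move: fy0|move: fx0]; apply: contraNneq => h.
    have -> : y = c; last by rewrite fc.
    apply: p_only; rewrite (_ : p = x) //.
    by apply: (@perm_inj _ f); apply: val_inj; rewrite fp /= h.
  have -> : x = c; last by rewrite fc.
  apply: p_only; rewrite sym_e (_ : p = y) //.
  by apply: (@perm_inj _ f); apply: val_inj; rewrite fp /= h.
have [h|/forallPn[x /forallPn[y]]] :=
  boolP [forall x, forall y, kbar m.+2 (f x) (f y) ==> e x y].
  case: niso; exists f => x y; apply/idP/idP; first exact: sub_f.
  by move: x y h => x y /forallP/(_ x)/forallP/(_ y)/implyP.
rewrite negb_imply => /andP[kf ne].
exact: (kbar_spanning_subgraph_lambda1 R m0 sym_e sub_f kf ne).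
Qed.

(** * Arithmetic for the all-ones test vector *)

Lemma many_isolated_arith s i n E :
  odd n -> (7 <= n)%N -> (2 <= s)%N -> (s <= i)%N -> (s + i <= n)%N ->
  (2 * s < n)%N -> (i * (n - s - 1) + (n - s - i) * i <= E)%N ->
  (3 * (n - 2) * n ^ 2 <= E * (n ^ 2 + E) + 3)%N.
Proof.
move=> oddn n7 s2 si sin sn hE.
(* Here t is the excess of i over s and w counts the vertices that are neither in the barrier nor
   isolated. The bound on E is weakened to one in s and t + w alone. *)
have [t def_i] : exists t, i = (s + t)%N by exists (i - s)%N; lia.
have [w def_n] : exists w, n = (2 * s + t + w)%N by exists (n - 2 * s - t)%N; lia.
have {hE} hE : (s * (s + 2 * (t + w) - 1) <= E)%N.
  apply: leq_trans hE.
  have -> : (n - s - 1 = s + t + w - 1)%N by lia.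
  have -> : (n - s - i = w)%N by lia.
  rewrite def_i; case: t {def_i def_n} => [|t]; first by nia.
  have -> : (s + 2 * (t.+1 + w) - 1 = s + 2 * t + 1 + 2 * w)%N by lia.
  have -> : (s + t.+1 + w - 1 = s + t + w)%N by lia.
  nia.
have [u def_u] : exists u, u = (t + w)%N by exists (t + w)%N.
have {}def_n : n = (2 * s + u)%N by lia.
rewrite -def_u in hE.
have u1 : (1 <= u)%N by lia.
(* If E >= 3 (n - 2), multiplying by n^2 suffices. Otherwise E is so small that only three pairs (s,
   u) survive. *)
have [hE3|hE3] := leqP (3 * (n - 2)) E; first by nia.
have lt_n : (s * (s + 2 * u - 1) < 3 * (2 * s + u - 2))%N by lia.
have [s6|s6] := leqP 6 s.
  by have := leq_mul s6 (leqnn (s + 2 * u - 1)); lia.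
have : [\/ s = 2 /\ u = 3, s = 3 /\ u = 1 | s = 4 /\ u = 1]%N.
  have : s \in [:: 2; 3; 4; 5] by rewrite !inE; lia.
  rewrite !inE; case/or4P => /eqP es; rewrite es in lt_n def_n *.
  - by constructor 1; split=> //; lia.
  - by constructor 2; split=> //; lia.
  - by constructor 3; split=> //; lia.
  - lia.
(* The pair s = 3, u = 1 uses the whole slack: n = 7, E >= 12 and 12 (49 + 12) + 3 = 3 * 5 * 49. *)
by rewrite def_n; case=> -[es eu]; subst s u; nia.
Qed.

(** As q > 3 (s - i) >= 3, the factor 3 q + i - 3 is at least 9, and 9 (n - s) >= 3 (n - 2). *)
Lemma many_components_arith s i q n E :
  (i < s)%N -> (3 * (s - i) < q)%N -> (3 * q + i <= n - s)%N ->
  ((n - s) * (3 * q + i - 3) <= E)%N ->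
  (3 * (n - 2) * n ^ 2 <= E * (n ^ 2 + E) + 3)%N.
Proof.
move=> lt_is lt_q le_n hE; suff hE3 : (3 * (n - 2) <= E)%N by nia.
apply: leq_trans hE.
have [d def_s] : exists d, s = (i + d)%N by exists (s - i)%N; lia.
have [t def_n] : exists t, (n - s = 3 * q + i + t)%N.
  by exists (n - s - (3 * q + i))%N; lia.
have [r def_q] : exists r, q = (3 * d + 1 + r)%N.
  by exists (q - (3 * d + 1))%N; lia.
have -> : (n - 2 = 3 * q + i + t + i + d - 2)%N by lia.
have -> : (3 * q + i - 3 = 9 * d + 3 * r + i)%N by lia.
rewrite def_n.
have h6 : (9 <= 9 * d + 3 * r + i)%N by lia.
apply: (@leq_trans ((3 * q + i + t) * 9)%N); first by lia.
by rewrite leq_mul2l h6 orbT.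
Qed.

(** * Case analysis on a non-empty barrier *)

Theorem theorem3 (R : realType) (k n : nat) (e : rel 'I_n) :
  odd k -> (3 <= k)%N -> odd n -> (3 <= n)%N ->
  simple_graph e -> connected_graph e ->
  (lambda1 (distmx R e) <= lambda1 (distmx R (kbar n)))%R ->
  ~ graph_iso e (kbar n) ->
  GFC k e.
Proof.
move=> oddk k3 oddn n3 simple_e conn_e le_l1 niso; split=> //; split=> // S S0 barS.
have {barS} := k_barrier_ineq oddk oddn n3 conn_e barS.
have sym_e : symmetric e by case: simple_e.
have := card_components_ge S sym_e.
have := nonadj_count_isolated S sym_e; have := nonadj_count_components S sym_e.
have s0 : (0 < #|S|)%N by rewrite card_gt0.
have -> : #|~: S| = (n - #|S|)%N by have := cardsC S; rewrite card_ord; lia.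
have le_s : (#|S| <= n)%N by have := max_card (mem S); rewrite card_ord.
move=> comp_count iso_count le_n bar.
suff : (lambda1 (distmx R (kbar n)) < lambda1 (distmx R e))%R by rewrite ltNge le_l1.
case: n e oddn n3 simple_e conn_e le_l1 niso S S0 sym_e s0 le_s comp_count iso_count le_n bar
  => [//|[//|m]] e oddn n3 simple_e conn_e _ niso S _ sym_e s0 le_s comp_count iso_count le_n bar.
have m0 : (0 < m)%N by [].
have [lt_is|le_si] := ltnP #|isolated e S| #|S|.
  (* The bound k >= 3 removes k from the barrier inequality. *)
  have lt_q : (3 * (#|S| - #|isolated e S|) < odd_comps e S)%N.
    apply: (@leq_ltn_trans (k * (#|S| - #|isolated e S|))%N); first by rewrite leq_mul2r k3 orbT.
    by rewrite mulnBr; have := leq_mul (leqnn k) (ltnW lt_is); lia.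
  have arith := many_components_arith lt_is lt_q le_n comp_count.
  apply: (all_ones_lambda1 R m0 sym_e _ (leqnn _)); first by lia.
  by rewrite subn2 in arith.
have [s1|s2] := leqP #|S| 1.
  have /cards1P[c def_S] : #|S| == 1%N by rewrite eqn_leq s1.
  have [p pI] : exists p, p \in isolated e S by apply/card_gt0P; lia.
  by rewrite def_S in pI; apply: cut_vertex_lambda1 niso pI.
(* If i = s, the barrier inequality yields a nontrivial odd component, which occupies three further
   vertices. *)
have lt_2s : (2 * #|S| < m.+2)%N.
  have [lt_si|ge_si] := ltnP #|S| #|isolated e S|; first by lia.
  have eq_si : #|isolated e S| = #|S| by lia.
  by rewrite eq_si in bar le_n; lia.
have le_si_n : (#|S| + #|isolated e S| <= m.+2)%N by lia.
have [n7|n7] := leqP 7 m.+2.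
  apply: (all_ones_lambda1 R m0 sym_e _ (leqnn _)); first by lia.
  have := many_isolated_arith oddn n7 s2 le_si le_si_n lt_2s iso_count.
  by rewrite subn2.
(* Since s >= 2 and 2 s < n, the only odd order below 7 is 5. *)
have m3 : m = 3%N by move: oddn; lia.
subst m.
apply: (independent3_lambda1 R sym_e (I := isolated e S)); last first.
  move=> x y xI yI; apply: isolatedP xI _.
  by have := fintype.subsetP (isolated_sub e S) y yI; rewrite inE.
have s2' : #|S| = 2%N by lia.
have [//|i3] := eqVneq #|isolated e S| 3%N.
(* Two isolated vertices would require an odd component of size at least 3 in the single vertex
   left. *)
have i2 : #|isolated e S| = 2%N by lia.
by rewrite i2 s2' in bar le_n; lia.
Qed.
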